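(* Fix any constant $c\ge1$. Let $\beta\in[0,1)$, $\gamma=1-\beta$ and $k\le n$. In the synchronous Broadcast version of the Data Retrieval model with $k$ peers, an $n$-bit source and a dynamic Byzantine adversary corrupting at most $\beta k$ peers in each round ($\beta$ known to the peers), there is a randomized protocol for Download, succeeding with probability at least $1-n^{-c}$, with worst-case time $O(\log^2 n)$ rounds, worst-case query complexity $O\!\left(\frac{n}{\gamma k}\log^2 n\right)$, and worst-case message size $O\!\left(\frac{n}{\gamma k}\log n\right)$ bits. (The hidden constants may depend on $c$ but not on $n,k,\beta$.)
   Context: Data Retrieval (DR) model. There are $k$ peers with unique IDs $1,\dots,k$ forming a complete network, and a trusted read-only external source storing an array $X=(b_1,\dots,b_n)\in\{0,1\}^n$, with $n\ge k$. A query $\mathrm{Query}(i)$ by a peer to the source returns $b_i$. Synchronous rounds: each round has three sub-rounds: (1) each peer sends any number (between $0$ and $n$) of queries to the source; (2) the source answers all of them; (3) peers exchange messages, delivered within the round. Broadcast model: in each round each peer, including a Byzantine one, sends at most one message, and that same message is delivered to all other peers; receivers know the sender's ID. Local computation is free and instantaneous. Dynamic Byzantine adversary: at the start of each round the adversary chooses, arbitrarily and adaptively, the set of at most $\beta k$ peers that are Byzantine (corrupted) in that round; a peer may be Byzantine in one round and nonfaulty in the next. Byzantine peers behave arbitrarily in that round (subject to the broadcast constraint); the other peers follow the protocol in that round, using the messages delivered to them so far. The adversary chooses $X$. Peers generate private local random bits. At the beginning of round $t$ the adversary knows $X$, all local random bits generated up to round $t-1$ and all communication up to round $t-1$. Download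 problem: every peer that is nonfaulty when outputting must output an array equal to $X$; the protocol succeeds if this holds. Complexity measures: query complexity = maximum number of bits queried by a peer while nonfaulty; time = number of rounds; message size = maximum number of bits in one message sent by a nonfaulty peer. *)

(* Defs.v *)
From HB Require Import structures.
From mathcomp Require Import all_boot all_order all_algebra.
From mathcomp Require Import reals exp.

Set Implicit Arguments.
Unset Strict Implicit.
Unset Printing Implicit Defensive.

Import Order.TTheory GRing.Theory Num.Theory.
Local Open Scope ring_scope.

(* A message is a bit string; None means that the peer stays silent. *)
Definition message := option (seq bool).
Definition message_size (m : message) : nat := oapp size 0%N m.

(* Messages broadcast in one round, indexed by the (known) sender. *)
Definition messages (k : nat) := {ffun 'I_k -> message}.

(* Fresh private random bits of all the peers in one round. *)
Definition coins (k r : nat) := {ffun 'I_k -> r.-tuple bool}.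

(* Answers of the source to the queries of one peer in one round: Some b at
   the queried indices, None elsewhere. *)
Definition answers (n : nat) := {ffun 'I_n -> option bool}.

Definition Query (n : nat) (X : n.-tuple bool) (Q : {set 'I_n}) : answers n :=
  [ffun j => if j \in Q then Some (tnth X j) else None].

(* What a peer privately retains from one round. *)
Definition record (n r : nat) := (r.-tuple bool * answers n)%type.

(* The information held by one peer at the beginning of a round; both lists
   are chronological, with one entry for each past round. The broadcast log
   includes the peer's own messages. *)
Record view (n k r : nat) := View {
  received : seq (messages k);
  memory : seq (record n r)
}.

(* The round number is the length of the lists in the view. [query] precedes
   [answers] within a round, and [send] depends on the answers obtained in that
   same round; the output is computed after the last message exchange. *)
Record protocol (n k : nat) := Protocol {
  rounds : nat;
  random_bits : nat; (* per peer and per round *)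
  query : 'I_k -> view n k random_bits -> random_bits.-tuple bool ->
          {set 'I_n};
  send : 'I_k -> view n k random_bits -> random_bits.-tuple bool ->
         answers n -> message;
  output : 'I_k -> view n k random_bits -> n.-tuple bool
}.

(* The adversary's knowledge at the beginning of a round. *)
Record history (k r : nat) := History {
  past_coins : seq (coins k r);
  past_messages : seq (messages k)
}.

(* [corrupt] is the set of Byzantine peers of the coming round. [act] gives,
   for each Byzantine peer of that round, the message it broadcasts and what
   its private memory retains of the round (both arbitrary); it may depend on
   the coins drawn in this round by the Byzantine peers, and only by them.
   Everything below quantifies over the source array before the adversary,
   which may therefore depend on it. *)
Record adversary (n k r : nat) := Adversary {
  corrupt : history k r -> {set 'I_k};
  act : history k r -> {ffun 'I_k -> option (r.-tuple bool)} -> 'I_k ->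
        message * record n r
}.

Definition bounded_adversary (R : realType) (beta : R) (n k r : nat)
    (A : adversary n k r) : Prop :=
  forall h : history k r, #|corrupt A h|%:R <= beta * k%:R.

Record state (n k r : nat) := State {
  hist : history k r;
  memories : 'I_k -> seq (record n r);
  byzantine : {set 'I_k};  (* Byzantine peers of the last completed round *)
  queried : 'I_k -> nat;   (* bits queried so far while nonfaulty *)
  max_message : nat        (* longest message sent so far while nonfaulty *)
}.

Definition init_state (n k r : nat) : state n k r :=
  State (History [::] [::]) (fun=> [::]) set0 (fun=> 0%N) 0%N.

Definition view_of (n k r : nat) (s : state n k r) (i : 'I_k) : view n k r :=
  View (past_messages (hist s)) (memories s i).

Definition round (n k : nat) (P : protocol n k)
    (A : adversary n k (random_bits P)) (X : n.-tuple bool)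
    (s : state n k (random_bits P)) (w : coins k (random_bits P)) :
    state n k (random_bits P) :=
  let h := hist s in
  let B := corrupt A h in
  let Q := fun i => query i (view_of s i) (w i) in
  let a := fun i => Query X (Q i) in
  let z := act A h [ffun i => if i \in B then Some (w i) else None] in
  let m : messages k :=
    [ffun i => if i \in B then (z i).1
               else send i (view_of s i) (w i) (a i)] in
  State (History (rcons (past_coins h) w) (rcons (past_messages h) m))
        (fun i => rcons (memories s i) (if i \in B then (z i).2
                                        else (w i, a i)))
        B
        (fun i => (queried s i + (if i \in B then 0 else #|Q i|))%N)
        (maxn (max_message s) (\max_(i | i \notin B) message_size (m i))).

(* All the randomness of an execution. *)
Definition outcome (n k : nat) (P : protocol n k) :=
  (rounds P).-tuple (coins k (random_bits P)).

Definition final_state (n k : nat) (P : protocol n k)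
    (A : adversary n k (random_bits P)) (X : n.-tuple bool)
    (w : outcome P) : state n k (random_bits P) :=
  foldl (round A X) (init_state n k (random_bits P)) w.

Definition download_succeeds (n k : nat) (P : protocol n k)
    (A : adversary n k (random_bits P)) (X : n.-tuple bool)
    (w : outcome P) : bool :=
  let s := final_state A X w in
  [forall i, (i \notin byzantine s) ==> (output i (view_of s i) == X)].

(* The random bits are independent and fair, i.e. the outcome is uniform. *)
Definition success_probability (R : realType) (n k : nat) (P : protocol n k)
    (A : adversary n k (random_bits P)) (X : n.-tuple bool) : R :=
  #|[pred w : outcome P | download_succeeds A X w]|%:R / #|{: outcome P}|%:R.

(* The worst cases are over the source array, the adversary, and all the
   outcomes of the random bits. *)
Definition query_complexity_le (R : realType) (beta : R) (n k : nat)
    (P : protocol n k) (q : R) : Prop :=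
  forall (X : n.-tuple bool) (A : adversary n k (random_bits P)),
    bounded_adversary beta A ->
    forall (w : outcome P) (i : 'I_k),
      (queried (final_state A X w) i)%:R <= q.

Definition message_size_le (R : realType) (beta : R) (n k : nat)
    (P : protocol n k) (l : R) : Prop :=
  forall (X : n.-tuple bool) (A : adversary n k (random_bits P)),
    bounded_adversary beta A ->
    forall w : outcome P, (max_message (final_state A X w))%:R <= l.

Definition success_probability_ge (R : realType) (beta : R) (n k : nat)
    (P : protocol n k) (p : R) : Prop :=
  forall (X : n.-tuple bool) (A : adversary n k (random_bits P)),
    bounded_adversary beta A -> p <= success_probability R A X.

(* Main.v *)
(* The array is cut into about gamma k / log n blocks, merged two by two over
   log n levels. All broadcasts are common knowledge, so all peers maintain the
   same table giving, for each resolved block, at most 16 / gamma candidate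
   contents, one of which is right. In each round a peer draws a random
   unresolved block of the current level, learns its content with few queries
   (positions separating the candidates of its sub-blocks) and broadcasts the
   answers. The content of a block becomes a candidate when it has as many
   supporters as a constant fraction of the expected number of nonfaulty peers
   drawing the block: the truth always qualifies with high probability. Since
   a peer supports only one content, the number of candidates per unresolved
   block is O(1 / gamma) on average, so at least half of the unresolved blocks
   get few candidates and are resolved: log n rounds suffice at each level.
   Nothing relies on private memory across rounds, except the answers of the
   last round, which a nonfaulty peer uses to select the right candidate for
   the whole array. When gamma k = O(log n), every peer queries the whole array. *)

Require Import Defs.
From mathcomp Require Import all_boot all_order all_algebra.
From mathcomp Require Import reals sequences exp.
From mathcomp Require Import zify ring lra.
Import Order.TTheory GRing.Theory Num.Theory.

(** * Separating sets of positions *)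

Section Separators.

Set Implicit Arguments.
Unset Strict Implicit.

Variable n : nat.

Definition separates (L : {set n.-tuple bool}) (D : {set 'I_n}) : bool :=
  [forall y in L, forall z in L,
    [forall x in D, tnth y x == tnth z x] ==> (y == z)].

Lemma separatesP (L : {set n.-tuple bool}) (D : {set 'I_n}) :
  reflect ({in L &, forall y z, {in D, tnth y =1 tnth z} -> y = z})
          (separates L D).
Proof.
apply: (iffP forall_inP) => [sepL y z yL zL eqyz|sepL y yL].
  move/forall_inP: (sepL y yL) => /(_ z zL) /implyP /(_ _) /eqP; apply.
  by apply/forall_inP => x xD; rewrite eqyz.
apply/forall_inP => z zL; apply/implyP => /forall_inP eqyz.
by apply/eqP; apply: sepL => // x /eqyz /eqP.
Qed.

Lemma separates_setT (L : {set n.-tuple bool}) : separates L setT.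
Proof.
by apply/separatesP => y z _ _ eqyz; apply: eq_from_tnth => x; rewrite eqyz.
Qed.

(** Induction on [L]: a set separating [L :\ y] confuses [y] with at most one other content, so one
    more position is enough. *)
Lemma separates_exists (L : {set n.-tuple bool}) :
  exists2 D : {set 'I_n}, separates L D & #|D| <= #|L|.
Proof.
have [m] := ubnP #|L|; elim: m L => // m IHm L; rewrite ltnS => leLm.
have [->|[y yL]] := set_0Vmem L.
  exists set0; last by rewrite !cards0.
  by apply/separatesP => y z; rewrite inE.
have [|D /separatesP sepD leD] := IHm (L :\ y).
  by apply: leq_trans leLm; rewrite (cardsD1 y L) yL.
have [D' [sDD' leD' sepy]] : exists D' : {set 'I_n},
    [/\ D \subset D', #|D'| <= #|D|.+1
      & {in L, forall z, {in D', tnth y =1 tnth z} -> y = z}].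
  (* At most one z in L :\ y agrees with y on D: one more index tells it from y. *)
  have [|nex] := boolP [exists z in L :\ y, [forall x in D, tnth y x == tnth z x]].
    case/exists_inP => z zL /forall_inP eqyz.
    have neqzy : z != y by move: zL; rewrite !inE => /andP[].
    have [x neqx] : exists x, tnth y x != tnth z x.
      apply/existsP; apply: contraR neqzy; rewrite negb_exists => /forallP eqall.
      by apply/eqP/eq_from_tnth => x; move: (eqall x); rewrite negbK => /eqP.
    exists (x |: D); rewrite subsetUr; split=> //.
      by rewrite (leq_trans (leq_card_setU _ _)) // cards1.
    move=> z' z'L agree; apply/eqP; apply: contraNT neqx => neqyz'.
    have <- : z' = z; last by apply/eqP/agree; rewrite setU11.
    apply: sepD => //; first by rewrite !inE eq_sym neqyz'.
    by move=> x' x'D; rewrite -agree ?setU1r //; apply/eqP/eqyz.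
  exists D; split=> // z zL yz; apply/eqP; apply: contraT => neq.
  move: nex; rewrite negb_exists_in => /forall_inP/(_ z).
  rewrite !inE eq_sym neq zL => /(_ isT)/negP[].
  by apply/forall_inP => x /yz ->.
exists D'; last first.
  by rewrite (leq_trans leD') // (cardsD1 y L) yL ltnS.
apply/separatesP => y1 y2 y1L y2L agree.
have [e1|neq1] := eqVneq y1 y.
  by rewrite e1; apply: sepy => // x /agree; rewrite e1.
have [e2|neq2] := eqVneq y2 y.
  by rewrite e2; apply/esym/sepy => // x /agree; rewrite e2.
apply: sepD; rewrite ?inE ?neq1 ?neq2 // => x /(subsetP sDD'); exact: agree.
Qed.

(** A choice depending on [L] alone, so that all peers compute the same set. *)
Definition separator (L : {set n.-tuple bool}) : {set 'I_n} :=
  [arg min_(D < [set: 'I_n] | separates L D) #|D|].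

Lemma separatorP (L : {set n.-tuple bool}) : separates L (separator L).
Proof. by rewrite /separator; case: arg_minnP => //; apply: separates_setT. Qed.

Lemma card_separator (L : {set n.-tuple bool}) : #|separator L| <= #|L|.
Proof.
rewrite /separator; case: arg_minnP => [|D _ minD]; first exact: separates_setT.
by have [D' /minD/leq_trans] := separates_exists L; apply.
Qed.

Definition restrict (D : {set 'I_n}) (z : n.-tuple bool) : n.-tuple bool :=
  [tuple (x \in D) && tnth z x | x < n].

Lemma tnth_restrict (D : {set 'I_n}) z x :
  tnth (restrict D z) x = (x \in D) && tnth z x.
Proof. by rewrite tnth_mktuple. Qed.

Lemma restrict_sub (D E : {set 'I_n}) z :
  D \subset E -> restrict D (restrict E z) = restrict D z.
Proof.
move=> /subsetP sDE; apply: eq_from_tnth => x; rewrite !tnth_restrict.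
by case: (boolP (x \in D)) => // /sDE ->.
Qed.

Lemma restrictT z : restrict setT z = z.
Proof. by apply: eq_from_tnth => x; rewrite tnth_restrict inE. Qed.

Lemma sum_card_fibers (I : finType) (E : eqType) (f : I -> E) (r : seq E) :
  uniq r -> \sum_(e <- r) #|[set i | f i == e]| <= #|I|.
Proof.
move=> uniq_r.
under eq_bigr do rewrite -sum1dep_card big_mkcond.
rewrite exchange_big /= -sum1_card; apply: leq_sum => i _.
rewrite -big_mkcond /= sum1_count (eq_count (a2 := pred1 (f i))).
  by rewrite count_uniq_mem ?leq_b1.
by move=> e; rewrite /= eq_sym.
Qed.

End Separators.

(** * Union bound over the steps of an adaptive process *)

Section Independence.

Set Implicit Arguments.
Unset Strict Implicit.

Variables (S : Type) (W : finType) (good : S -> W -> bool) (next : S -> W -> S).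

Fixpoint all_along (st : S) (ws : seq W) : bool :=
  if ws is w :: ws' then good st w && all_along (next st w) ws' else true.

Local Open Scope ring_scope.

(** The rarity bound holds from every state, hence whatever the past: the union bound over the [m]
    steps survives adaptivity. *)
Lemma card_not_all_along (R : realType) (eps : R) :
  (forall st, #|[pred w | ~~ good st w]|%:R <= eps * #|W|%:R) ->
  forall m st, #|[pred ws : m.-tuple W | ~~ all_along st ws]|%:R
               <= m%:R * eps * #|{: m.-tuple W}|%:R.
Proof.
move=> rare; elim=> [|m IH] st.
  rewrite !mul0r eq_card0 // => ws; rewrite inE.
  by rewrite (tuple0 ws).
have split_card : #|[pred ws : m.+1.-tuple W | ~~ all_along st ws]| =
    (\sum_(w : W) #|[pred ws : m.-tuple W | ~~ all_along st (w :: ws)]|)%N.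
  pose glue (x : W * m.-tuple W) := [tuple of x.1 :: x.2].
  rewrite -sum1_card (reindex glue) /=.
    under [RHS]eq_bigr do rewrite -sum1_card.
    by rewrite pair_big_dep /=; apply: eq_bigl => -[].
  exists (fun t : m.+1.-tuple W => (thead t, [tuple of behead t])).
    move=> [w ws] _.
    by rewrite theadE /=; congr (_, _); apply: val_inj.
  by move=> t _; rewrite /glue -tuple_eta.
rewrite split_card natr_sum card_tuple expnS -(card_tuple m W) natrM.
have bound w : #|[pred ws : m.-tuple W | ~~ all_along st (w :: ws)]|%:R <=
    (~~ good st w)%:R * #|{: m.-tuple W}|%:R + m%:R * eps * #|{: m.-tuple W}|%:R.
  rewrite /=; case: (good st w) => /=; first by rewrite mul0r add0r IH.
  have card_ge0 : 0 <= m%:R * eps * #|{: m.-tuple W}|%:R :> R.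
    exact: le_trans (ler0n _ _) (IH st).
  by rewrite mul1r ler_wpDr // ler_nat max_card.
apply: le_trans (ler_sum _ (fun w _ => bound w)) _.
rewrite big_split /= -mulr_suml sumr_const -natr_sum.
have -> : (\sum_w ~~ good st w)%N = #|[pred w | ~~ good st w]|.
  rewrite -sum1_card [RHS]big_mkcond; apply: eq_bigr => w _.
  by rewrite inE; case: good.
have := rare st; set b := _%:R => rare_st.
rewrite -[_ *+ #|W|]mulr_natr.
have := ler_wpM2r (ler0n R #|{: m.-tuple W}|) rare_st.
rewrite -[in m.+1%:R]addn1 natrD; set q := _%:R; set v := #|W|%:R; lra.
Qed.

End Independence.

(** * The block protocol *)

Section BlockProtocol.

Set Implicit Arguments.
Unset Strict Implicit.

Variables (n k p s h : nat).

(* Level 0 consists of single bits; the blocks of level j.+1 have 2 ^ j * s bits. *)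
Definition width (j : nat) : nat := if j is j'.+1 then s * 2 ^ j' else 1.

Definition block (j u : nat) : {set 'I_n} := [set x : 'I_n | x %/ width j == u].

Definition nblocks (j : nat) : nat := (n.-1 %/ width j).+1.

(* T j u collects the candidate contents of block u of level j, padded with false
   outside of the block; it is set0 as long as the block is unresolved. *)
Definition table := nat -> nat -> {set n.-tuple bool}.

Definition unresolved (T : table) (j : nat) : seq nat :=
  [seq u <- iota 0 (nblocks j) | T j u == set0].

Definition queries (T : table) (j u : nat) : {set 'I_n} :=
  block j u :&:
  \bigcup_(x in block j u) separator (T j.-1 (x %/ width j.-1)).

(** Block numbers are written with exactly [p] bits, so that the label of a vote can be told from
    the answers that follow it. *)
Definition labels : seq (seq bool) := map val (enum {: p.-tuple bool}).

Definition label (u : nat) : seq bool := nth [::] labels u.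

Definition vote (T : table) (j u : nat) (f : 'I_n -> bool) : seq bool :=
  label u ++ [seq f x | x <- enum (queries T j u)].

Definition supporters (T : table) (j u : nat) (m : messages k)
    (z : n.-tuple bool) : {set 'I_k} :=
  [set i | m i == Some (vote T j u (tnth z))].

Definition consistent (T : table) (j u : nat) (z : n.-tuple bool) : bool :=
  (z == restrict (block j u) z) &&
  [forall x in block j u,
     restrict (block j.-1 (x %/ width j.-1)) z \in T j.-1 (x %/ width j.-1)].

(** [h] is a lower bound on the number of nonfaulty peers. With U the list of unresolved blocks, at
    least h / (2 |U|) of them are expected to draw a given block of U; the threshold is a quarter of
    this. *)
Definition candidates (T : table) (j u : nat) (m : messages k) :
    {set n.-tuple bool} :=
  [set z | consistent T j u z &
    h <= 8 * size (unresolved T j) * #|supporters T j u m z|].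

(* Twice the average number of candidates, which is at most 8 k / h. *)
Definition max_candidates : nat := 16 * k %/ h.

Definition level (t : nat) : nat := (t %/ p).+1.

(** A block without candidates receives [set0], that is, stays unresolved. *)
Definition update (t : nat) (T : table) (m : messages k) : table :=
  fun j u =>
    if [&& j == level t, T j u == set0 &
           #|candidates T j u m| <= max_candidates]
    then candidates T j u m else T j u.

Definition initial_table : table := fun j u =>
  if j is 0 then [set restrict (block 0 u) [tuple b | _ < n] | b : bool]
  else set0.

Definition table_of (log : seq (messages k)) : table :=
  (foldl (fun tT m => (tT.1.+1, update tT.1 tT.2 m)) (0, initial_table) log).2.

(* The reduction modulo size U makes the draw slightly nonuniform: a given block
   is drawn with probability at least 1 / (2 * size U). *)
Definition draw (U : seq nat) (b : p.-tuple bool) : nat :=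
  nth 0 U (enum_rank b %% size U).

Definition choice_of (log : seq (messages k)) (b : p.-tuple bool) : nat :=
  draw (unresolved (table_of log) (level (size log))) b.

Definition agrees (a : answers n) (z : n.-tuple bool) : bool :=
  [forall x, (a x == None) || (a x == Some (tnth z x))].

(* The top level is p.+1. The last round, of index p * p.+1, belongs to level p.+2,
   whose only block is drawn by every peer: its queries separate the candidates
   for the whole array. *)
Definition block_protocol : protocol n k :=
  @Protocol n k (p * p.+1).+1 p
    (fun _ v b => let log := received v in
       queries (table_of log) (level (size log)) (choice_of log b))
    (fun _ v b a => let log := received v in
       Some (vote (table_of log) (level (size log)) (choice_of log b)
                  (fun x => odflt false (a x))))
    (fun _ v =>
       let a := (last ([tuple false | _ < p], [ffun=> None]) (memory v)).2 in
       odflt [tuple false | _ < n]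
         [pick z in table_of (received v) p.+1 0 | agrees a z]).

Lemma table_of_rcons log m :
  table_of (rcons log m) = update (size log) (table_of log) m.
Proof.
rewrite /table_of foldl_rcons /=; congr update.
by elim/last_ind: log => // log m' IH; rewrite foldl_rcons size_rcons /= IH.
Qed.

(** * Blocks, votes and query counts *)

Hypotheses (n_gt0 : 0 < n) (p_gt0 : 0 < p) (s_gt0 : 0 < s) (ltn2p : n < 2 ^ p).
Hypotheses (h_gt0 : 0 < h) (le_hk : h <= k).

Lemma width_dvdn j : width j %| width j.+1.
Proof. by case: j => [|j] /=; rewrite ?dvd1n // expnSr mulnA dvdn_mulr. Qed.

Lemma div_width j (x : nat) :
  x %/ width j.+1 = (x %/ width j) %/ (width j.+1 %/ width j).
Proof. by rewrite -divnMA mulnC divnK // width_dvdn. Qed.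

Lemma block_prev j u (x : 'I_n) :
  x \in block j.+1 u -> block j (x %/ width j) \subset block j.+1 u.
Proof.
rewrite inE => /eqP <-; apply/subsetP => y; rewrite !inE => /eqP yx.
by rewrite !div_width yx.
Qed.

Lemma mem_block_self j (x : 'I_n) : x \in block j (x %/ width j).
Proof. by rewrite inE. Qed.

Lemma div_width_lt j (x : 'I_n) : x %/ width j < nblocks j.
Proof. by rewrite /nblocks ltnS leq_div2r // -ltnS prednK. Qed.

Lemma card_block u : #|block 1 u| <= s.
Proof.
rewrite cardE -(size_map val).
have /uniq_leq_size : uniq (map val (enum (block 1 u))).
  by rewrite map_inj_uniq ?enum_uniq //; apply: val_inj.
move/(_ (iota (u * s) s)); rewrite size_iota; apply=> x /mapP[y].
rewrite mem_enum inE /= muln1 => /eqP yu ->; rewrite mem_iota.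
by rewrite (divn_eq y s) yu leq_addr ltn_add2l ltn_mod.
Qed.

Lemma nblocks_le j : nblocks j <= n.
Proof. by rewrite /nblocks (leq_ltn_trans (leq_div _ _)) // prednK. Qed.

Lemma nblocks_level1 j : nblocks j.+1 <= (n.-1 %/ s).+1.
Proof. by rewrite ltnS /= divnMA leq_div. Qed.

Lemma nblocks_last j : p < j -> nblocks j = 1.
Proof.
case: j => // j; rewrite ltnS => lepj; rewrite /nblocks divn_small //=.
rewrite prednK // (leq_trans (ltnW ltn2p)) // (leq_trans (leq_pexp2l _ lepj)) //.
by rewrite leq_pmull.
Qed.

Lemma block_last j : p < j -> block j 0 = setT.
Proof.
move=> ltpj; apply/setP => x; rewrite !inE.
by have := div_width_lt j x; rewrite nblocks_last // ltnS leqn0.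
Qed.

Lemma unresolved_uniq (T : table) j : uniq (unresolved T j).
Proof. by rewrite filter_uniq // iota_uniq. Qed.

Lemma mem_unresolved (T : table) j u :
  (u \in unresolved T j) = (u < nblocks j) && (T j u == set0).
Proof. by rewrite mem_filter mem_iota andbC. Qed.

Lemma size_unresolved_nblocks (T : table) j : size (unresolved T j) <= nblocks j.
Proof. by rewrite size_filter (leq_trans (count_size _ _)) // size_iota. Qed.

Lemma size_labels : size labels = 2 ^ p.
Proof. by rewrite size_map -cardE card_tuple card_bool. Qed.

Lemma labels_uniq : uniq labels.
Proof. by rewrite map_inj_uniq ?enum_uniq //; apply: val_inj. Qed.

Lemma size_label u : u < 2 ^ p -> size (label u) = p.
Proof.
rewrite -size_labels => /(mem_nth [::]) /mapP[b _]; rewrite -/(label u) => ->.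
exact: size_tuple.
Qed.

Lemma size_label_le u : size (label u) <= p.
Proof.
have [/size_label -> //|leu] := ltnP u (2 ^ p).
by rewrite /label nth_default // size_labels.
Qed.

Lemma label_inj u v : u < 2 ^ p -> v < 2 ^ p -> label u = label v -> u = v.
Proof.
rewrite -size_labels => ltu ltv /eqP.
by rewrite nth_uniq ?labels_uniq // => /eqP.
Qed.

Lemma queries_sub (T : table) j u : queries T j u \subset block j u.
Proof. exact: subsetIl. Qed.

Lemma vote_eq (T : table) j u f g :
  {in queries T j u, f =1 g} -> vote T j u f = vote T j u g.
Proof.
by move=> eqfg; congr (_ ++ _); apply/eq_in_map => x; rewrite mem_enum => /eqfg.
Qed.

Lemma consistent_restrict (T : table) j u X :
  (forall x : 'I_n, x \in block j.+1 u ->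
     restrict (block j (x %/ width j)) X \in T j (x %/ width j)) ->
  consistent T j.+1 u (restrict (block j.+1 u) X).
Proof.
move=> TX; rewrite /consistent restrict_sub // eqxx; apply/forall_inP => x xu /=.
by rewrite restrict_sub ?TX // block_prev.
Qed.

(* The separators of the pieces of a block separate the ways to assemble them. *)
Lemma consistent_inj (T : table) j u y z :
  consistent T j.+1 u y -> consistent T j.+1 u z ->
  {in queries T j.+1 u, tnth y =1 tnth z} -> y = z.
Proof.
case/andP => /eqP ey /forall_inP Ty /andP[/eqP ez /forall_inP Tz] agree.
apply: eq_from_tnth => x; rewrite ey ez !tnth_restrict.
have [xu /=|//] := boolP (x \in block j.+1 u).
have /separatesP sep := separatorP (T j (x %/ width j)).
suff /(congr1 (fun w : n.-tuple bool => tnth w x)) :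
    restrict (block j (x %/ width j)) y = restrict (block j (x %/ width j)) z.
  by rewrite !tnth_restrict mem_block_self.
apply: sep (Ty x xu) (Tz x xu) _ => x' sx'.
rewrite !tnth_restrict; case: (boolP (x' \in _)) => //= x'v.
apply: agree; rewrite inE (subsetP (block_prev xu) _ x'v) /=.
by apply/bigcupP; exists x.
Qed.

(** Labels have equal lengths, so a vote determines its block; the answers then determine the
    content by [consistent_inj]. *)
Lemma vote_inj (T : table) j u v y z :
  u < nblocks j.+1 -> v < nblocks j.+1 ->
  consistent T j.+1 u y -> consistent T j.+1 v z ->
  vote T j.+1 u (tnth y) = vote T j.+1 v (tnth z) -> (u, y) = (v, z).
Proof.
have small w : w < nblocks j.+1 -> w < 2 ^ p.
  by move/leq_trans; apply; rewrite (leq_trans (nblocks_le _)) // ltnW.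
move=> /small ltu /small ltv cy cz /eqP.
rewrite eqseq_cat ?size_label // => /andP[/eqP/label_inj euv]; move: cy; rewrite {}euv //.
move=> cy /eqP/eq_in_map agree; congr (_, _); apply: consistent_inj cy cz _.
by move=> x xQ; apply: agree; rewrite mem_enum.
Qed.

(** A block of level [j.+2] has two halves, numbered 2u and 2u + 1, and each contributes one
    separator. *)
Lemma queries_card (T : table) j u : (forall v, #|T j.+1 v| <= max_candidates) ->
  #|queries T j.+2 u| <= 2 * max_candidates.
Proof.
move=> leT.
have sepT v : #|separator (T j.+1 v)| <= max_candidates.
  exact: leq_trans (card_separator _) (leT v).
have sub : queries T j.+2 u \subset
    separator (T j.+1 (u * 2)) :|: separator (T j.+1 (u * 2).+1).
  apply/subsetP => x /setIP[_ /bigcupP[y yu /= xy]]; rewrite inE.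
  have : (y %/ (s * 2 ^ j)) %/ 2 = u.
    by move: yu; rewrite inE /= expnSr mulnA divnMA => /eqP.
  move=> eu; move: xy; rewrite (divn_eq (y %/ (s * 2 ^ j)) 2) eu.
  have := ltn_pmod (y %/ (s * 2 ^ j)) (isT : 0 < 2).
  case: (_ %% 2) => [|[|//]] _; rewrite ?addn0 ?addn1 => ->; rewrite ?orbT //.
apply: leq_trans (subset_leq_card sub) _; apply: leq_trans (leq_card_setU _ _) _.
by rewrite mul2n -addnn leq_add.
Qed.

Lemma table_of_card log j u : #|table_of log j.+1 u| <= max_candidates.
Proof.
elim/last_ind: log => [|log m IH]; first by rewrite /table_of /= cards0.
by rewrite table_of_rcons /update; case: ifP => // /and3P[].
Qed.

(** The first [p] rounds treat level 1, where the pieces are single bits and the whole block may be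
    queried. *)
Lemma queries_table_card (log : seq (messages k)) u :
  #|queries (table_of log) (level (size log)) u| <=
  if size log < p then s else 2 * max_candidates.
Proof.
case: ltnP => [lts|les].
  rewrite /level divn_small //.
  exact: leq_trans (subset_leq_card (queries_sub _ _ _)) (card_block _).
have : 0 < size log %/ p by rewrite divn_gt0.
rewrite /level; case: (_ %/ p) => // j _.
by apply: queries_card => v; apply: table_of_card.
Qed.

(* Together the candidates of the unresolved blocks need h |candidates| / (8 |U|)
   supporters, and each peer supports one of them: few blocks have many. *)
Lemma unresolved_halves (T : table) j m :
  2 * count (fun u => max_candidates < #|candidates T j.+1 u m|)
            (unresolved T j.+1) <= size (unresolved T j.+1).
Proof.
set U := unresolved T j.+1; set C := fun u => candidates T j.+1 u m.
have memU u : u \in U -> u < nblocks j.+1 by rewrite mem_unresolved => /andP[].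
have disjoint_support :
    \sum_(u <- U) \sum_(z in C u) #|supporters T j.+1 u m z| <= k.
  (* Distinct pairs of a block and a candidate have distinct votes, and a peer broadcasts one
     message: the sets of supporters are disjoint. *)
  pose r := [seq Some (vote T j.+1 u (tnth z)) | u <- U, z <- enum (C u)].
  have uniq_r : uniq r.
    apply: allpairs_uniq_dep => [|u _|]; [exact: unresolved_uniq|exact: enum_uniq|].
    move=> _ _ /allpairsPdep[u [y [uU yC ->]]] /allpairsPdep[v [z [vU zC ->]]] /= [].
    move: yC zC; rewrite !mem_enum !inE => /andP[cy _] /andP[cz _].
    by move/(vote_inj (memU _ uU) (memU _ vU) cy cz) => [-> ->].
  have := sum_card_fibers m uniq_r; rewrite card_ord; apply: leq_trans.
  rewrite big_allpairs_dep; apply: leq_sum => u _.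
  by rewrite big_enum.
have support u : h * #|C u| <=
    8 * size U * \sum_(z in C u) #|supporters T j.+1 u m z|.
  rewrite mulnC -sum_nat_const big_distrr /=.
  by apply: leq_sum => z; rewrite inE => /andP[].
have lt16k : 16 * k < max_candidates.+1 * h by rewrite ltn_ceil.
set bad := (fun u => _).
have : h * (max_candidates.+1 * count bad U) <= 8 * size U * k.
  apply: leq_trans (leq_mul (leqnn (8 * size U)) disjoint_support).
  rewrite big_distrr -sum1_count !big_distrr /=.
  rewrite [leqRHS](bigID bad) /= (leq_trans _ (leq_addr _ _)) //.
  apply: leq_sum => u badu; rewrite muln1; apply: leq_trans (support u).
  by rewrite leq_mul2l; apply/orP; right.
have k_gt0 : 0 < k by apply: leq_trans le_hk.
(* Here 16 k c <= h (max_candidates + 1) c <= 8 e k, whence 2 c <= e. *)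
set c := count bad U; set e := size U; nia.
Qed.

(** * Invariant of the table of candidates *)

Variable X : n.-tuple bool.

Definition sound (T : table) : Prop := forall j u,
  u < nblocks j -> T j u != set0 -> restrict (block j u) X \in T j u.

Definition settled (T : table) (j : nat) : Prop :=
  forall u, u < nblocks j -> T j u != set0.

(** Invariant before round [t]: the levels below the current one are resolved, and each of the t mod
    p rounds already spent on the current level has halved its unresolved blocks. *)
Definition on_track (t : nat) (T : table) : Prop :=
  [/\ sound T, (forall j, j <= t %/ p -> settled T j) &
      size (unresolved T (level t)) * 2 ^ (t %% p) <= nblocks (level t)].

Lemma on_track_initial : on_track 0 initial_table.
Proof.
have bit u : u < nblocks 0 -> restrict (block 0 u) X \in initial_table 0 u.
  rewrite /nblocks divn1 prednK // => ltun.
  apply/imsetP; exists (tnth X (Ordinal ltun)) => //.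
  apply: eq_from_tnth => x; rewrite !tnth_restrict tnth_mktuple.
  case: (boolP (x \in _)); rewrite // inE divn1 => /eqP xu.
  by congr tnth; apply: val_inj.
split=> [[|j] u ltu||]; rewrite ?eqxx //; first by move=> _; apply: bit.
  move=> j; rewrite div0n leqn0 => /eqP -> u ltu.
  by apply/set0Pn; exists (restrict (block 0 u) X); apply: bit.
by rewrite mod0n muln1 size_unresolved_nblocks.
Qed.

Lemma update_resolved t (T : table) m j u : T j u != set0 ->
  update t T m j u = T j u.
Proof. by rewrite /update => /negPf ->; rewrite andbF. Qed.

Lemma update_other t (T : table) m j u : j != level t ->
  update t T m j u = T j u.
Proof. by rewrite /update => /negPf ->. Qed.

Lemma on_track_update t (T : table) (m : messages k) :
  let U := unresolved T (level t) in
  (forall u, u \in U ->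
     h <= 8 * size U * #|[set i | m i == Some (vote T (level t) u (tnth X))]|) ->
  on_track t T -> on_track t.+1 (update t T m).
Proof.
move=> U votes [soundT settledT sizeU].
have truth u : u \in U ->
    restrict (block (level t) u) X \in candidates T (level t) u m.
  move=> uU; rewrite inE; apply/andP; split.
    apply: consistent_restrict => x _; apply: soundT; first exact: div_width_lt.
    by apply: settledT (leqnn _) _ _; apply: div_width_lt.
  apply: leq_trans (votes u uU) _; rewrite leq_mul2l; apply/orP; right.
  apply/eq_leq/eq_card => i; rewrite !inE.
  rewrite (@vote_eq _ _ _ (tnth X) (tnth (restrict (block (level t) u) X))) //.
  by move=> x /(subsetP (queries_sub _ _ _)) xu; rewrite tnth_restrict xu.
have settled_update j : settled T j -> settled (update t T m) j.
  by move=> settledj u ltu; rewrite update_resolved settledj.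
(* Since the truth is a candidate, a block can stay unresolved only by having too many
   candidates. *)
have halved : 2 * size (unresolved (update t T m) (level t)) <= size U.
  apply: leq_trans (unresolved_halves T (t %/ p) m); rewrite leq_mul2l /=.
  rewrite -/(level t) -size_filter; apply: uniq_leq_size.
    exact: unresolved_uniq.
  move=> u; rewrite mem_unresolved => /andP[ltu].
  rewrite mem_filter [_ \in U]mem_unresolved ltu /= /update eqxx /=.
  have [Tu0 /=|/negPf -> //] := eqVneq (T (level t) u) set0.
  rewrite andbT; case: leqP => //= _ /eqP Cu0.
  by have := truth u; rewrite Cu0 inE mem_unresolved ltu Tu0 eqxx => /(_ isT).
have sound_update : sound (update t T m).
  move=> j u ltu; rewrite {1}/update.
  case: ifPn => [/and3P[/eqP ej Tu0 leC] _|_ Tu]; last first.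
    by rewrite update_resolved // soundT.
  rewrite /update ej eqxx -ej Tu0 leC /= ej; apply: truth.
  by rewrite mem_unresolved -ej ltu.
have et : t.+1 = t %/ p * p + (t %% p).+1 by rewrite addnS -divn_eq.
have [lt_mod|ge_mod] := ltnP (t %% p).+1 p.
  have [ediv emod] : t.+1 %/ p = t %/ p /\ t.+1 %% p = (t %% p).+1.
    by rewrite et divnMDl // modnMDl (divn_small lt_mod) addn0 modn_small.
  split=> //; first by move=> j; rewrite ediv => /settledT/settled_update.
  rewrite /level ediv emod -/(level t) expnS mulnA [_ * 2]mulnC.
  exact: leq_trans (leq_mul halved (leqnn _)) sizeU.
have emod' : (t %% p).+1 = p by apply/eqP; rewrite eqn_leq ltn_mod p_gt0.
have [ediv emod] : t.+1 %/ p = (t %/ p).+1 /\ t.+1 %% p = 0.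
  by rewrite et emod' divnMDl // modnMDl divnn p_gt0 modnn addn1.
split=> //; last by rewrite emod muln1 size_unresolved_nblocks.
move=> j; rewrite ediv leq_eqVlt => /predU1P[->|]; last first.
  by rewrite ltnS => /settledT/settled_update.
move=> u ltu; apply/negP => Tu0.
have : u \in unresolved (update t T m) (level t) by rewrite mem_unresolved ltu.
suff : size (unresolved (update t T m) (level t)) == 0 by move=> /nilP ->.
(* After [p] halvings the number of unresolved blocks is at most n / 2^p < 1. *)
have : size (unresolved (update t T m) (level t)) * 2 ^ p < 2 ^ p.
  apply: leq_ltn_trans ltn2p; apply: leq_trans (nblocks_le (level t)).
  apply: leq_trans sizeU; rewrite -[in 2 ^ p]emod' expnS mulnA [_ * 2]mulnC.
  by rewrite leq_mul2r halved orbT.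
by rewrite -{2}[2 ^ p]mul1n ltn_pmul2r ?expn_gt0 // ltnS leqn0.
Qed.

(** * Executions against an adversary *)

Variable A : adversary n k (random_bits block_protocol).

Notation run := (foldl (@Defs.round n k block_protocol A X)).
Notation start := (init_state n k (random_bits block_protocol)).
Notation log st := (past_messages (hist st)).

(** The Byzantine set is a function of the history, so it is fixed before the coins [w] are
    drawn. *)
Definition favourable (st : state n k p) (w : coins k p) : bool :=
  let U := unresolved (table_of (log st)) (level (size (log st))) in
  all (fun u => h <= 8 * size U *
         #|[set i | (i \notin corrupt A (hist st)) && (draw U (w i) == u)]|) U.

Definition all_favourable : state n k p -> seq (coins k p) -> bool :=
  all_along favourable (@Defs.round n k block_protocol A X).

Lemma all_favourable_rcons (st : state n k p) ws w :
  all_favourable st (rcons ws w) -> all_favourable st ws.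
Proof.
by rewrite /all_favourable; elim: ws st => //= w' ws IH st /andP[-> /IH].
Qed.

Lemma log_round (st : state n k p) w :
  exists m : messages k,
    log (@Defs.round n k block_protocol A X st w) = rcons (log st) m /\
    forall i, i \notin corrupt A (hist st) ->
      m i = Some (vote (table_of (log st)) (level (size (log st)))
                       (choice_of (log st) (w i)) (tnth X)).
Proof.
eexists; split=> [|i iB]; first by [].
rewrite ffunE (negPf iB) /=; congr Some; apply: vote_eq => x xQ.
by rewrite ffunE xQ.
Qed.

Lemma size_log_run ws : size (log (run start ws)) = size ws.
Proof.
elim/last_ind: ws => // ws w IH; rewrite foldl_rcons size_rcons -IH.
by have [m [-> _]] := log_round (run start ws) w; rewrite size_rcons.
Qed.

Lemma on_track_round (st : state n k p) w :
  favourable st w -> on_track (size (log st)) (table_of (log st)) ->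
  let st' := @Defs.round n k block_protocol A X st w in
  on_track (size (log st')) (table_of (log st')).
Proof.
move=> /allP good track st'; rewrite {}/st'.
have [m [-> votes]] := log_round st w.
rewrite size_rcons table_of_rcons; apply: on_track_update track => u uU.
apply: leq_trans (good u uU) _; rewrite leq_mul2l; apply/orP; right.
apply: subset_leq_card; apply/subsetP => i; rewrite !inE => /andP[iB /eqP <-].
by apply/eqP/votes.
Qed.

Lemma on_track_run ws : all_favourable start ws ->
  on_track (size ws) (table_of (log (run start ws))).
Proof.
move=> good; rewrite -[size ws]size_log_run.
have : on_track (size (log start)) (table_of (log start)).
  exact: on_track_initial.
move: good; rewrite /all_favourable.
elim: ws start => //= w ws IH st /andP[good goods] track.
by apply: IH goods _; apply: on_track_round.
Qed.

(** In the last round every nonfaulty peer draws the only block of level [p.+2], and its queries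
    separate the candidates for the whole array, among them [X]. Only the answers of that round are
    read from memory, so an earlier corruption of [i] is harmless. *)
Lemma output_correct ws w i :
  size ws = p * p.+1 -> all_favourable start ws ->
  let st := run start ws in i \notin corrupt A (hist st) ->
  output i (view_of (@Defs.round n k block_protocol A X st w) i) = X.
Proof.
move=> size_ws good st iB.
have [soundT settledT _] := on_track_run good.
have level_ws : level (size ws) = p.+2 by rewrite /level size_ws mulKn.
have last_block : 0 < nblocks p.+1 by [].
set T := table_of (log st) in soundT settledT.
have XT : X \in T p.+1 0.
  have := soundT p.+1 0 last_block; rewrite block_last // restrictT; apply.
  by apply: settledT; rewrite // size_ws mulKn.
have choice0 : choice_of (log st) (w i) = 0.
  rewrite /choice_of size_log_run level_ws /draw.
  set U := unresolved _ _; set q := _ %% _.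
  (* When [U] is empty, the default 0 of [nth] is still the right block. *)
  have [ltq|leq] := ltnP q (size U); last by rewrite nth_default.
  have := mem_nth 0 ltq; rewrite mem_unresolved nblocks_last // ltnS leqn0.
  by case/andP => /eqP.
rewrite /= (negPf iB) last_rcons /= choice0 size_log_run level_ws -/T.
set a := Query _ _.
(* The last update concerns level [p.+2] and keeps the candidates that the queries were chosen to
   separate. *)
rewrite table_of_rcons update_other ?size_log_run ?level_ws -?/T; last first.
  by rewrite neq_ltn ltnSn.
have agreesX : agrees a X.
  by apply/forallP => x; rewrite ffunE; case: ifP; rewrite eqxx ?orbT.
case: pickP => [z /andP[zT agz]|/(_ X)]; last by rewrite XT agreesX.
have /separatesP sep := separatorP (T p.+1 0).
apply: sep => // x xs /=.
have xQ : x \in queries T p.+2 0.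
  rewrite in_setI block_last // in_setT; apply/bigcupP; exists x => //.
  have := div_width_lt p.+1 x; rewrite nblocks_last // ltnS leqn0 => /eqP ex.
  by rewrite [p.+2.-1]/= ex.
by move/forallP: agz => /(_ x); rewrite ffunE xQ /= => /eqP[->].
Qed.

(** Level 1 is paid for by the first term, all later levels by the second. *)
Lemma queried_run ws i :
  queried (run start ws) i <=
  minn (size ws) p * s + size ws * (2 * max_candidates).
Proof.
elim/last_ind: ws => // ws w IH; rewrite foldl_rcons size_rcons /=.
have : (if i \in corrupt A (hist (run start ws)) then 0 else
    #|queries (table_of (log (run start ws))) (level (size (log (run start ws))))
       (choice_of (log (run start ws)) (w i))|) <=
    if size ws < p then s else 2 * max_candidates.
  by case: ifP => // _; rewrite -size_log_run queries_table_card.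
set q := (X in X <= _); set q' := queried _ _ in IH *; set d := 2 * _ in IH *.
rewrite -/q' => leq; apply: leq_trans (leq_add IH leq) _.
case: ltnP => [lts|les].
  by rewrite (minn_idPl lts) !mulSn addnAC [s + _]addnC leq_add // leq_addl.
by rewrite (minn_idPr (leqW les)) mulSn -addnA [d + _]addnC.
Qed.

Lemma max_message_run ws :
  max_message (run start ws) <= p + s + 2 * max_candidates.
Proof.
elim/last_ind: ws => // ws w IH; rewrite foldl_rcons /= geq_max IH /=.
apply/bigmax_leqP => i iB; rewrite ffunE (negPf iB) /= size_cat size_map -cardE.
rewrite -addnA leq_add ?size_label_le //.
by apply: leq_trans (queries_table_card _ _) _; case: ifP; lia.
Qed.

End BlockProtocol.

(** * Probability of an unfavourable execution *)

Section Tail.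

Set Implicit Arguments.
Unset Strict Implicit.

Variables (R : realType) (k p : nat).

(** The codes a |U| + index(u), with a below the integer part of 2^p / |U|, all select [u]; as |U|
    <= 2^p, rounding down loses at most a factor 2. *)
Lemma card_draw (U : seq nat) (u : nat) :
  size U <= 2 ^ p -> u \in U ->
  2 ^ p <= 2 * size U * #|[pred b : p.-tuple bool | draw U b == u]|.
Proof.
move=> leU uU; have U_gt0 : 0 < size U by case: U uU {leU}.
set l := size U in leU U_gt0 *; pose q := 2 ^ p %/ l.
have card_bits : #|{: p.-tuple bool}| = 2 ^ p by rewrite card_tuple card_bool.
have idx_lt : index u U < l by rewrite index_mem.
have lt_code (a : 'I_q) : a * l + index u U < #|{: p.-tuple bool}|.
  rewrite card_bits (leq_trans _ (leq_divM (2 ^ p) l)) // -/q.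
  rewrite (leq_trans (_ : _ < a.+1 * l)) ?leq_mul2r ?ltn_ord ?orbT //.
  by rewrite mulSn addnC ltn_add2r.
pose f (a : 'I_q) : p.-tuple bool := enum_val (Ordinal (lt_code a)).
have f_inj : injective f.
  move=> a a' /enum_val_inj /(congr1 val) /= /eqP.
  by rewrite eqn_add2r eqn_pmul2r // => /eqP/val_inj.
have le_q : q <= #|[pred b : p.-tuple bool | draw U b == u]|.
  rewrite -(card_ord q) -(card_image f_inj); apply: subset_leq_card.
  apply/subsetP => _ /imageP[a _ ->]; rewrite inE /draw /f enum_valK /=.
  by rewrite modnMDl modn_small // nth_index.
apply: leq_trans (leq_mul (leqnn (2 * l)) le_q).
have q_gt0 : 0 < q by rewrite divn_gt0.
have := ltn_ceil (2 ^ p) U_gt0; rewrite -/q; nia.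
Qed.

Local Open Scope ring_scope.

(* Markov's inequality for 2 ^- N, where N is the number of peers of H drawing u. *)
Lemma few_draws (H : {set 'I_k}) (U : seq nat) (u h : nat) :
  (size U <= 2 ^ p)%N -> u \in U -> (h <= #|H|)%N ->
  #|[pred w : coins k p |
      (8 * size U * #|[set i | (i \in H) && (draw U (w i) == u)]| < h)%N]|%:R
  <= expR (- (h%:R / (8 * size U)%:R)) * #|{: coins k p}|%:R :> R.
Proof.
move=> leU uU leh; have U_gt0 : (0 < size U)%N by case: U uU {leU}.
set l := size U in leU U_gt0 *; set bad := [pred w | _].
pose N (w : coins k p) := #|[set i | (i \in H) && (draw U (w i) == u)]|.
pose F i (b : p.-tuple bool) : R := if (i \in H) && (draw U b == u) then 2^-1 else 1.
pose M : R := (2 ^ p)%:R; pose x : R := (8 * l)%:R.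
have x_gt0 : 0 < x by rewrite ltr0n muln_gt0.
have M_ge0 : 0 <= M by [].
have F_ge0 i b : 0 <= F i b by rewrite /F; case: ifP => _; rewrite ?invr_ge0.
have prodF (w : coins k p) : \prod_i F i (w i) = 2^-1 ^+ N w.
  rewrite -big_mkcond /= prodr_const; congr (_ ^+ _).
  by apply: eq_card => i; rewrite !inE.
have expN1 : expR (-1) <= 2^-1 :> R.
  by rewrite expRN lef_pV2 ?posrE ?expR_gt0 // (le_trans _ (expR_ge1Dx 1)).
(* On a bad outcome N < h / x, and 1/2 >= exp(-1). *)
have bad_weight (w : coins k p) : w \in bad -> expR (- (h%:R / x)) <= \prod_i F i (w i).
  rewrite inE => badw; rewrite prodF.
  have : expR (- (N w)%:R) <= 2^-1 ^+ N w :> R.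
    by rewrite -mulrN1 expRM_natl lerXn2r // ?nnegrE ?expR_ge0 ?invr_ge0.
  apply: le_trans; rewrite ler_expR lerN2 ler_pdivlMr // -natrM ler_nat mulnC.
  exact: ltnW.
(* By [card_draw] at least 4 M / x strings select [u]; each loses weight 1/2, and 1 - 2 / x <=
   exp(-2 / x). *)
have sumF i : i \in H -> \sum_b F i b <= M * expR (- (2 / x)).
  move=> iH; pose a := #|[pred b : p.-tuple bool | draw U b == u]|.
  have -> : \sum_b F i b = M - a%:R / 2.
    have -> : M = \sum_(b : p.-tuple bool) 1.
      by rewrite sumr_const card_tuple card_bool.
    have -> : a%:R = \sum_(b : p.-tuple bool) (draw U b == u)%:R :> R.
      rewrite /a -sum1_card natr_sum big_mkcond; apply: eq_bigr => b _.
      by rewrite inE; case: eqP.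
    rewrite mulr_suml -sumrB; apply: eq_bigr => b _.
    by rewrite /F iH /=; case: eqP => _ /=; lra.
  have le_a : M * (4 / x) <= a%:R.
    have := card_draw leU uU; rewrite -(ler_nat R) -/a -/l natrM -/M => le_a.
    rewrite mulrA ler_pdivrMr // /x natrM; rewrite natrM in le_a; lra.
  have := expR_ge1Dx (- (2 / x)).
  move/(ler_wpM2l M_ge0); apply: le_trans; rewrite mulrDr mulr1; lra.
have sumF' i : i \notin H -> \sum_b F i b = M.
  move=> /negPf iH; under eq_bigr do rewrite /F iH.
  by rewrite sumr_const card_tuple card_bool.
have total : \sum_(w : coins k p) \prod_i F i (w i) <=
    M ^+ k * expR (- (2 * h%:R / x)).
  (* Independence of the peers: the sum of products factors into a product of sums. *)
  rewrite -(bigA_distr_bigA F) (bigID (mem H)) /=.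
  rewrite [X in _ * X](eq_bigr (fun=> M)) // prodr_const.
  have ltH : \prod_(i in H) \sum_b F i b <= (M * expR (- (2 / x))) ^+ #|H|.
    rewrite -prodr_const; apply: ler_prod => i iH; rewrite sumF // andbT.
    by apply: sumr_ge0.
  apply: le_trans (ler_wpM2r _ ltH) _; first exact: exprn_ge0.
  have -> : #|[predC H]| = (k - #|H|)%N.
    have := cardC (mem H); rewrite card_ord.
    by set a := #|_|; set a' := #|_|; lia.
  rewrite exprMn mulrAC -exprD subnKC; last first.
    by rewrite -[leqRHS]card_ord max_card.
  rewrite ler_wpM2l ?exprn_ge0 // -expRM_natl ler_expR mulrN lerN2.
  rewrite mulrA ler_wpM2r ?invr_ge0 ?(ltW x_gt0) // mulrC ler_wpM2r //.
  by rewrite ler_nat.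
have cardM : #|{: coins k p}|%:R = M ^+ k :> R.
  by rewrite card_ffun card_tuple card_bool card_ord natrX.
rewrite cardM.
have : #|bad|%:R * expR (- (h%:R / x)) <= M ^+ k * expR (- (2 * h%:R / x)).
  apply: le_trans total; rewrite (bigID (mem bad)) /= mulr_natl -sumr_const.
  rewrite ler_wpDr //; last by apply: ler_sum.
  by apply: sumr_ge0 => w _; apply: prodr_ge0.
rewrite (_ : - (2 * h%:R / x) = - (h%:R / x) + - (h%:R / x)); last by lra.
by rewrite expRD mulrA ler_pM2r ?expR_gt0 // mulrC.
Qed.

End Tail.

(** * Success probability of the block protocol *)

Section Success.

Set Implicit Arguments.
Unset Strict Implicit.

Variables (R : realType) (n k p s h : nat).
Hypotheses (n_gt0 : 0 < n) (p_gt0 : 0 < p) (s_gt0 : 0 < s) (ltn2p : n < 2 ^ p).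
Hypotheses (h_gt0 : 0 < h) (le_hk : h <= k).

Notation P := (block_protocol n k p s h).

Variables (X : n.-tuple bool) (A : adversary n k (random_bits P)).
Hypothesis enough_honest : forall hi, h <= #|~: corrupt A hi|.

Local Open Scope ring_scope.

Let rate : R := expR (- (h%:R / (8 * (n.-1 %/ s).+1)%:R)).

(** Union bound over the at most [n] unresolved blocks; [rate] uses the number of blocks of level 1,
    the largest among the levels treated. *)
Lemma card_not_favourable (st : state n k p) :
  #|[pred w | ~~ favourable A st w]|%:R <= n%:R * rate * #|{: coins k p}|%:R.
Proof.
set T := table_of n p s h (past_messages (hist st)).
set U := unresolved s T (level p (size (past_messages (hist st)))).
have leUn : (size U <= n)%N.
  exact: leq_trans (size_unresolved_nblocks _ _ _) (nblocks_le _ n_gt0 _).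
have leUs : (size U <= (n.-1 %/ s).+1)%N.
  exact: leq_trans (size_unresolved_nblocks _ _ _) (nblocks_level1 _ _ _).
pose fail u := [pred w : coins k p | (8 * size U *
  #|[set i | (i \in ~: corrupt A (hist st)) && (draw U (w i) == u)]| < h)%N].
have union : (#|[pred w | ~~ favourable A st w]| <= \sum_(u <- U) #|fail u|)%N.
  under eq_bigr do rewrite -sum1_card big_mkcond.
  rewrite exchange_big /= -sum1_card big_mkcond; apply: leq_sum => w _.
  rewrite inE /favourable -/T -/U.
  case: allPn => //= -[u uU]; rewrite -ltnNge => fail_u.
  rewrite (big_rem u) //= inE; set b := (X in (X < h)%N).
  suff -> : (b < h)%N by [].
  apply: leq_ltn_trans fail_u; rewrite leq_mul2l; apply/orP; right.
  by apply/eq_leq/eq_card => i; rewrite !inE.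
apply: (@le_trans _ _ (\sum_(u <- U) #|fail u|)%N%:R); first by rewrite ler_nat.
rewrite natr_sum big_seq.
apply: (@le_trans _ _ (\sum_(u <- U | u \in U) rate * #|{: coins k p}|%:R)).
  apply: ler_sum => u uU.
  apply: le_trans (few_draws R _ uU (enough_honest _)) _.
    by rewrite (leq_trans leUn) // ltnW.
  rewrite ler_wpM2r // ler_expR lerN2 ler_wpM2l //.
  rewrite lef_pV2 ?posrE ?ltr0n ?muln_gt0 //.
    by rewrite ler_nat leq_mul2l leUs orbT.
  by case: U uU {leUn leUs fail union}.
rewrite -big_seq big_const_seq count_predT iter_addr_0 -[X in X <= _]mulr_natl mulrA.
rewrite ler_wpM2r // ler_wpM2r ?expR_ge0 // ler_nat //.
Qed.

Lemma block_protocol_success :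
  1 - (p * p.+1).+1%:R * (n%:R * rate) <= success_probability R A X.
Proof.
have rare := card_not_all_along (@Defs.round n k P A X) card_not_favourable
  (p * p.+1).+1 (init_state n k (random_bits P)).
have total_gt0 : 0 < #|{: outcome P}|%:R :> R.
  rewrite ltr0n card_tuple card_ffun !expn_gt0.
  by rewrite card_tuple card_bool expn_gt0.
rewrite /success_probability ler_pdivlMr // mulrBl mul1r lerBlDr.
apply: le_trans (lerD (lexx _) rare); rewrite -natrD ler_nat.
rewrite -(cardC [pred w : outcome P | download_succeeds A X w]) leq_add2l.
apply: subset_leq_card; apply/subsetP => w; rewrite !inE; apply: contra => good.
apply/forallP => i; apply/implyP => iB; apply/eqP; move: iB.
rewrite /final_state; case: w good => /= w /eqP.
case/lastP: w => // ws w; rewrite size_rcons => -[size_ws] good.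
rewrite foldl_rcons => iB; apply: output_correct => //.
exact: all_favourable_rcons good.
Qed.

End Success.

(** * Choice of the parameters *)

Section Direct.

Set Implicit Arguments.
Unset Strict Implicit.

Variables n k : nat.

(** Used with t = 1 when gamma k is small, and with t = 0 when n = 1. *)
Definition direct_protocol (t : nat) : protocol n k :=
  @Protocol n k t 0 (fun _ _ _ => setT) (fun _ _ _ _ => None)
    (fun _ v => [tuple odflt false
       ((last ([tuple], [ffun=> None]) (memory v)).2 x) | x < n]).

Variables (t : nat) (X : n.-tuple bool).
Variable A : adversary n k (random_bits (direct_protocol t)).

Lemma direct_queried w i : queried (final_state A X w) i <= t * n.
Proof.
rewrite /final_state -[t in t * n](size_tuple w).
elim/last_ind: (tval w) => //= ws w' IH; rewrite foldl_rcons size_rcons /=.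
rewrite mulSn addnC leq_add //; case: ifP => // _.
by rewrite -[leqRHS]card_ord max_card.
Qed.

Lemma direct_max_message w : max_message (final_state A X w) = 0.
Proof.
rewrite /final_state; elim/last_ind: (tval w) => //= ws w' IH.
rewrite foldl_rcons /= IH max0n big1 // => i iB.
by rewrite ffunE (negPf iB).
Qed.

Lemma direct_succeeds w : 0 < t -> download_succeeds A X w.
Proof.
move=> t_gt0; apply/forallP => i; apply/implyP; rewrite /final_state.
case: w => w /= /eqP; case/lastP: w => [e|ws w _]; first by rewrite -e in t_gt0.
rewrite foldl_rcons => iB; rewrite /= (negPf iB) last_rcons /=.
by apply/eqP/eq_from_tnth => x; rewrite tnth_mktuple ffunE inE.
Qed.

End Direct.

(** Amounts to exp(-1/2) >= 1 - 1/2. *)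
Lemma ln2_ge_half (R : realType) : (2^-1 <= ln 2 :> R)%R.
Proof.
have pos2 : (0 < 2 :> R)%R by [].
rewrite -ler_expR lnK ?posrE //.
have := expR_ge1Dx (- 2^-1 : R)%R; rewrite expRN => le.
rewrite -[2%R in leRHS]invrK -[leLHS]invrK lef_pV2 ?posrE ?invr_gt0 ?expR_gt0 //.
lra.
Qed.

Lemma rounds_mul_le_expn (p n : nat) :
  p <= n -> 1 < n -> (p * p.+1).+1 * n <= n ^ 4.
Proof.
move=> le_pn n_gt1; rewrite expnSr leq_mul2r; apply/orP; right.
apply: (@leq_trans (n * n.+1).+1); first by rewrite ltnS leq_mul.
by rewrite !expnS expn0 muln1; nia.
Qed.

(** * Bounds in terms of n, gamma k and ln n *)

Section Specifications.

Set Implicit Arguments.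
Unset Strict Implicit.

Local Open Scope ring_scope.

Variable R : realType.

Lemma phases_le (n : nat) : (1 < n)%N ->
  (trunc_log 2 n).+1%:R <= 4 * ln n%:R :> R.
Proof.
move=> n_gt1; have n_gt0 := ltnW n_gt1.
have half := ln2_ge_half R.
have le2n : ln 2 <= ln n%:R :> R by rewrite ler_ln ?posrE ?ltr0n // ler_nat.
have : (2 ^ trunc_log 2 n)%:R <= n%:R :> R by rewrite ler_nat trunc_logP.
rewrite natrX -ler_ln ?posrE ?ltr0n ?exprn_gt0 // lnXn // -[ln 2 *+ _]mulr_natr.
rewrite -[(trunc_log 2 n).+1%:R]natr1; set l := (trunc_log 2 n)%:R => le.
have : 2^-1 * l <= ln 2 * l by rewrite ler_wpM2r.
lra.
Qed.

Lemma phases_lt (n : nat) : (1 < n)%N -> ((trunc_log 2 n).+1 <= n)%N.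
Proof.
move=> n_gt1; apply: leq_trans (ltn_expl _ (isT : (1 < 2)%N)) _.
exact: trunc_logP (ltnW n_gt1).
Qed.

Lemma direct_protocol_spec (n k t : nat) (beta : R) :
  [/\ query_complexity_le beta (direct_protocol n k t) (t * n)%:R,
      message_size_le beta (direct_protocol n k t) 0 &
      (0 < t)%N -> success_probability_ge beta (direct_protocol n k t) 1].
Proof.
split=> [X A _ w i|X A _ w|t_gt0 X A _].
- by rewrite ler_nat direct_queried.
- by rewrite direct_max_message.
rewrite /success_probability (@eq_card _ _ {: outcome (direct_protocol n k t)}).
  rewrite divff // pnatr_eq0 -lt0n card_tuple card_ffun !expn_gt0.
  by rewrite card_tuple.
by move=> w; rewrite !inE direct_succeeds.
Qed.

(** Blocks of about 16 K (n / g) L bits bring the failure probability of one block in one round down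
    to n^(-K). As K = c + 4, a factor n^4 remains for the union bound over rounds and blocks. *)
Lemma block_protocol_spec (c beta : R) (n k : nat) :
  1 <= c -> (0 < k)%N -> (k <= n)%N -> 0 <= beta -> beta < 1 -> (1 < n)%N ->
  16 * (c + 4) * ln n%:R <= (1 - beta) * k%:R ->
  let C := 128 * (c + 4) + 1536 in
  exists P : protocol n k,
    [/\ success_probability_ge beta P (1 - n%:R `^ (- c)),
        (rounds P)%:R <= C * ln n%:R ^+ 2,
        query_complexity_le beta P
          (C * (n%:R / ((1 - beta) * k%:R)) * ln n%:R ^+ 2)
      & message_size_le beta P (C * (n%:R / ((1 - beta) * k%:R)) * ln n%:R)].
Proof.
move=> c_ge1 k_gt0 le_kn beta_ge0 beta_lt1 n_gt1.
set g := (1 - beta) * k%:R; set L := ln n%:R; set K := c + 4 => g_ge C.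
have n_gt0 := ltnW n_gt1.
have L_ge : 2^-1 <= L.
  by apply: le_trans (ln2_ge_half R) _; rewrite ler_ln ?posrE ?ltr0n // ler_nat.
pose p := (trunc_log 2 n).+1.
have p_le : p%:R <= 4 * L by apply: phases_le.
have p_ge1 : 1 <= p%:R :> R by rewrite ler1n.
pose h := (k - Num.truncn (beta * k%:R))%N.
have betak_ge0 : 0 <= beta * k%:R by rewrite mulr_ge0.
have g_gt0 : 0 < g by rewrite mulr_gt0 ?subr_gt0 ?ltr0n.
have trunc_le : (Num.truncn (beta * k%:R))%:R <= beta * k%:R by rewrite truncn_le.
have le_trunc_k : (Num.truncn (beta * k%:R) <= k)%N.
  by rewrite -(ler_nat R) (le_trans trunc_le) // ler_piMl // ltW.
have g_le_h : g <= h%:R.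
  by rewrite natrB // /g mulrBl mul1r lerB.
have h_gt0 : (0 < h)%N by rewrite -(ltr0n R) (lt_le_trans g_gt0).
have le_hk : (h <= k)%N by apply: leq_subr.
have g_le_n : g <= n%:R by rewrite (le_trans g_le_h) // ler_nat (leq_trans le_hk).
pose r := n%:R / g.
have r_ge1 : 1 <= r by rewrite /r ler_pdivlMr // mul1r.
pose y := 16 * K * r * L.
have y_ge1 : 1 <= y.
  have : 1 <= (16 * K * L) by rewrite /K; nra.
  by rewrite /y => ?; nra.
pose s := (Num.truncn y).+1.
have y_lt_s : y < s%:R by apply: truncnS_gt.
have s_le : s%:R <= 2 * y.
  have : (Num.truncn y)%:R <= y by rewrite truncn_le; lra.
  by rewrite /s -[(Num.truncn y).+1%:R]natr1; lra.
have s_gt0 : (0 < s)%N by [].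
have ltn2p : (n < 2 ^ p)%N by apply: trunc_log_ltn.
pose d := max_candidates k h.
have d_le : d%:R <= 16 * r.
  have k_gt0' : 0 < k%:R :> R by rewrite ltr0n.
  have le_dh : d%:R * h%:R <= 16 * k%:R :> R by rewrite -!natrM ler_nat leq_divM.
  have le_dg : d%:R * g <= 16 * k%:R by apply: le_trans le_dh; rewrite ler_wpM2l.
  rewrite /r mulrA ler_pdivlMr // (le_trans le_dg) // ler_wpM2l // ler_nat //.
(* Since p >= 1, p (p + 1) + 1 <= 3 p^2 <= 3 (4 L)^2. *)
have rounds_le : (p * p.+1).+1%:R <= 48 * L ^+ 2.
  rewrite -[(p * p.+1).+1%:R]natr1 natrM -[p.+1%:R]natr1.
  by set q := p%:R in p_le p_ge1 *; nra.
exists (block_protocol n k p s h); split=> [X A boundA|||].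
- have honest hi : (h <= #|~: corrupt A hi|)%N.
    rewrite cardsCs setCK card_ord leq_sub2l // truncn_ge_nat //.
  apply: le_trans (block_protocol_success R n_gt0 (ltn0Sn _) s_gt0 ltn2p
                     h_gt0 le_hk X honest).
  rewrite lerD2l lerN2 /powR gt_eqF ?ltr0n //.
  set N := (n.-1 %/ s).+1.
  have N_gt0 : 0 < N%:R :> R by rewrite ltr0n.
  (* With N = a + 1: s > y gives 8 a K L <= g / 2, and the lower bound on g gives 8 K L <= g / 2. *)
  have N_le : 8 * N%:R * (K * L) <= h%:R.
    apply: le_trans g_le_h.
    have : (n.-1 %/ s)%:R * s%:R <= n%:R :> R.
      by rewrite -natrM ler_nat (leq_trans (leq_divM _ _)) // leq_pred.
    have ey : y * g = 16 * K * L * n%:R by rewrite /y /r; field; rewrite gt_eqF.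
    rewrite /N -[(n.-1 %/ s).+1%:R]natr1; set a := (n.-1 %/ s)%:R => le_an.
    have a_ge0 : 0 <= a by [].
    have le_ay : a * y <= n%:R.
      by apply: le_trans le_an; rewrite ler_wpM2l // ltW.
    have : a * (16 * K * L * n%:R) <= g * n%:R.
      by rewrite -ey mulrA [g * _]mulrC ler_wpM2r // ltW.
    rewrite mulrA ler_pM2r ?ltr0n //; lra.
  have exp_le : expR (- (h%:R / (8 * N)%:R)) <= expR (- (K * L)).
    rewrite ler_expR lerN2 ler_pdivlMr ?ltr0n // natrM; lra.
  have poly_le : (p * p.+1).+1%:R * n%:R <= n%:R ^+ 4 :> R.
    rewrite -natrX -natrM ler_nat.
    exact: rounds_mul_le_expn (phases_lt n_gt1) n_gt1.
  have expL : n%:R = expR L by rewrite lnK // posrE ltr0n.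
  rewrite mulrA; apply: le_trans (ler_pM _ _ poly_le exp_le) _;
    rewrite ?mulr_ge0 ?expR_ge0 //.
  rewrite [X in X ^+ 4]expL -expRM_natl -expRD -/L ler_expR /K; lra.
- rewrite (le_trans rounds_le) // /C /K ler_wpM2r ?sqr_ge0 //; lra.
- move=> X A boundA w i; rewrite -/r.
  have le_q : (queried (final_state A X w) i <=
               p * s + (p * p.+1).+1 * (2 * d))%N.
    apply: leq_trans (queried_run (ltn0Sn _) s_gt0 X A w i) _.
    by rewrite size_tuple leq_add // leq_mul2r geq_minr orbT.
  (* The constant [C] comes from here: 8 L y = 128 K r L^2 and 48 * 32 = 1536. *)
  apply: (@le_trans _ _ (4 * L * (2 * y) + 48 * L ^+ 2 * (2 * (16 * r)))).
    rewrite -(ler_nat R) in le_q; apply: le_trans le_q _.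
    rewrite natrD !natrM; apply: lerD; apply: ler_pM => //.
      by rewrite mulr_ge0.
    by rewrite ler_wpM2l.
  by rewrite le_eqVlt; apply/orP; left; apply/eqP; rewrite /y /C -/K; ring.
- move=> X A boundA w; rewrite -/r.
  have le_m : (max_message (final_state A X w) <= p + s + 2 * d)%N.
    exact: max_message_run n_gt0 (ltn0Sn _) s_gt0 ltn2p h_gt0 le_hk X A w.
  apply: (@le_trans _ _ (4 * L + 2 * y + 2 * (16 * r))).
    rewrite -(ler_nat R) in le_m; apply: le_trans le_m _.
    by rewrite 2!natrD natrM; apply: lerD; [apply: lerD|rewrite ler_wpM2l].
  (* Everything is absorbed into r L, using r >= 1 and L >= 1/2. *)
  have L_le : L <= r * L by rewrite ler_peMl //; lra.
  have r_le : r <= 2 * (r * L) by rewrite mulrCA ler_peMr //; lra.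
  have KrL_ge0 : 0 <= K * (r * L).
    apply: mulr_ge0; first by rewrite /K; lra.
    by apply: mulr_ge0; [exact: le_trans r_ge1|lra].
  have -> : C * r * L = 128 * (K * (r * L)) + 1536 * (r * L).
    by rewrite /C -/K; ring.
  have -> : 2 * y = 32 * (K * (r * L)) by rewrite /y; ring.
  move: L_le r_le KrL_ge0; set q := r * L; set z := K * q => L_le r_le z_ge0.
  lra.
Qed.

End Specifications.

Local Open Scope ring_scope.

Theorem theorem4p12 (R : realType) (c : R) (hc : 1 <= c) :
  exists C : R, 0 < C /\
    forall (n k : nat) (beta : R),
      (0 < k)%N -> (k <= n)%N -> 0 <= beta -> beta < 1 ->
      let gamma := 1 - beta in
      exists P : protocol n k,
        [/\ success_probability_ge beta P (1 - n%:R `^ (- c)),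
            (rounds P)%:R <= C * ln n%:R ^+ 2,
            query_complexity_le beta P
              (C * (n%:R / (gamma * k%:R)) * ln n%:R ^+ 2)
          & message_size_le beta P (C * (n%:R / (gamma * k%:R)) * ln n%:R)].
Proof.
exists (128 * (c + 4) + 1536); split; first lra.
move=> n k beta k_gt0 le_kn beta_ge0 beta_lt1 gamma.
set C := 128 * (c + 4) + 1536.
have C_ge0 : 0 <= C by rewrite /C; lra.
have g_gt0 : 0 < gamma * k%:R by rewrite mulr_gt0 ?subr_gt0 ?ltr0n.
have r_ge0 : 0 <= n%:R / (gamma * k%:R) by rewrite divr_ge0 // ltW.
(* For n = 1 all complexity bounds vanish because ln 1 = 0, but so does the required success
   probability. *)
have [n_le1|n_gt1] := leqP n 1.
  have [query_le message_le _] := direct_protocol_spec n k 0 beta.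
  exists (direct_protocol n k 0).
  have n1 : n = 1%N by apply/eqP; rewrite eqn_leq n_le1 (leq_trans k_gt0).
  have lnn : ln n%:R = 0 :> R by rewrite n1 ln1.
  split=> [X A _| |X A boundA w i|X A boundA w].
  - by rewrite [in X in 1 - X]n1 powR1 subrr divr_ge0.
  - by rewrite lnn expr0n mulr0.
  - by rewrite lnn expr0n mulr0; exact: query_le.
  - by rewrite lnn mulr0; exact: message_le.
have [le_g|lt_g] := lerP (16 * (c + 4) * ln n%:R) (gamma * k%:R).
  exact: block_protocol_spec.
have [query_le message_le success] := direct_protocol_spec n k 1 beta.
have L_ge : 2^-1 <= ln n%:R :> R.
  apply: le_trans (ln2_ge_half R) _.
  by rewrite ler_ln ?posrE ?ltr0n ?ler_nat // ltnW.
have L_ge0 : 0 <= ln n%:R :> R by apply: le_trans L_ge; rewrite invr_ge0.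
exists (direct_protocol n k 1); split.
- move=> X A boundA; apply: le_trans (success isT X A boundA).
  by rewrite gerBl powR_ge0.
- have : 2^-1 * 2^-1 <= ln n%:R ^+ 2 :> R by rewrite expr2 ler_pM ?invr_ge0.
  by rewrite /C /=; set q := ln n%:R ^+ 2; nra.
- move=> X A boundA w i; apply: le_trans (query_le X A boundA w i) _.
  (* gamma k < 16 (c + 4) ln n <= C (ln n)^2 because ln n >= 1/2; hence n queries fit the bound. *)
  have le_gC : gamma * k%:R <= C * ln n%:R ^+ 2.
    apply: le_trans (ltW lt_g) _; rewrite expr2 mulrA ler_wpM2r //.
    by rewrite /C; set L := ln _ in L_ge *; nra.
  by rewrite mul1n mulrAC mulrA ler_pdivlMr // mulrC ler_wpM2r.
move=> X A boundA w; apply: le_trans (message_le X A boundA w) _.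
by apply: mulr_ge0 => //; apply: mulr_ge0.
Qed.
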